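(* Let $t_1, t_2, t_3 \in (-1,1)$ and $\lambda \in [0,1]$. Then $$(t_1 + t_2 + t_3 + t_1 t_2 t_3)\, \operatorname{arctanh}\left( \frac{\lambda(t_1 + t_2 + t_3 + t_1 t_2 t_3)}{1 + \lambda(t_1 t_2 + t_2 t_3 + t_3 t_1)} \right) \le \lambda\, (t_1 + t_2 + t_3 + t_1 t_2 t_3) \sum_{i=1}^{3} \operatorname{arctanh}(t_i).$$
   Context: Here $\operatorname{arctanh}(x) = \frac{1}{2} \ln \frac{1+x}{1-x}$ for $x \in (-1,1)$. *)

(* Defs.v *)
From Stdlib Require Import Reals.
Local Open Scope R_scope.

(* The inverse hyperbolic tangent on (-1,1); outside that interval the value
   is a meaningless by-product of [ln] and [/] being total. *)
Definition arctanh (x : R) : R := 1 / 2 * ln ((1 + x) / (1 - x)).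

(* Main.v *)
Require Import Defs.
From Stdlib Require Import Reals Lra Psatz.
From Coquelicot Require Import Coquelicot.
Open Scope R_scope.

(** Put [P = (1+t1)(1+t2)(1+t3)], [M = (1-t1)(1-t2)(1-t3)] and write [S], [A] for
    half their difference and half their sum.  Then
    [S = t1 + t2 + t3 + t1 t2 t3] and [A = 1 + t1 t2 + t2 t3 + t3 t1], so twice
    the left-hand arctanh is
    [F l = ln (1 + l (P-1)) - ln (1 + l (M-1))], and twice the sum of the
    arctanh's is [ln P - ln M = F 1].  Changing the signs of all the [ti] changes
    the signs of [S] and of both arctanh terms, so it is enough to treat [S > 0],
    where the claim is the chord inequality [F l <= l * F 1].

    In general [F] is not convex.  However [F' c = (P-M) / Q c] for the quadratic
    [Q c = (1 + c (P-1)) (1 + c (M-1))], and [P * M = (1-t1²)(1-t2²)(1-t3²) <= 1]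
    leaves only two shapes for [Q]: decreasing on the unit interval, so that [F] is
    convex, or concave, so that [F'] can only decrease first and increase
    afterwards.  In the second case the chord inequality follows once it holds infinitesimally at 0, that is, once
    [F' 0 = P - M <= ln P - ln M] ([log_diff_below_chord]).

    This last inequality is [S <= arctanh t1 + arctanh t2 + arctanh t3]
    ([sum_le_sum_arctanh]).  If [A <= 1] it is immediate from
    [arctanh (S/A) >= S/A].  If [A > 1], fix [A]: AM-GM bounds [A² - S² = P * M] from above by its value when
    all the [ti] equal a common [t], and [arctanh (S/A) - S] increases in [S]
    beyond that point; so one is reduced to [t1 = t2 = t3 = t], which is
    [3 t + t³ <= 3 arctanh t]. *)

(** * The chord inequality *)

Lemma segment_from_1_pos (x c : R) :
  0 < x -> 0 <= c <= 1 -> 0 < 1 + c * (x - 1).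
Proof. intros hx hc. nra. Qed.

(** A point above the chord would give, by the mean value theorem on both
    sides of it, [c1 < c2] with [F' c1] larger and [F' c2] smaller than the slope
    [F 1].  As [F' = (P-M)/Q], this reads [Q c1 < m < Q c2] with
    [m = (P-M)/(ln P - ln M) <= 1 = Q 0], which is impossible both for a
    decreasing and for a concave [Q]. *)
Lemma log_diff_below_chord (P M l : R) :
  0 < M < P -> P * M <= 1 -> P - M <= ln P - ln M -> 0 <= l <= 1 ->
  ln (1 + l * (P - 1)) - ln (1 + l * (M - 1)) <= l * (ln P - ln M).
Proof.
  intros [hM hMP] hPM hslope hl.
  set (D := ln P - ln M) in *.
  set (g := fun c => ln (1 + c * (P - 1)) - ln (1 + c * (M - 1)) - c * D).
  set (Q := fun c => (1 + c * (P - 1)) * (1 + c * (M - 1))).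
  assert (Qpos : forall c, 0 <= c <= 1 -> 0 < Q c)
    by (intros c hc; apply Rmult_lt_0_compat; apply segment_from_1_pos; lra).
  assert (dg : forall c, 0 <= c <= 1 ->
             derivable_pt_lim g c ((P - M) / Q c - D)).
  { intros c hc. apply is_derive_Reals. unfold g.
    assert (hP := segment_from_1_pos P c ltac:(lra) hc).
    assert (hM' := segment_from_1_pos M c hM hc).
    auto_derive; [repeat split; lra|]. unfold Q. field; lra. }
  assert (g0 : g 0 = 0).
  { unfold g. rewrite !Rmult_0_l, Rplus_0_r, ln_1. ring. }
  assert (g1 : g 1 = 0).
  { unfold g, D. replace (1 + 1 * (P - 1)) with P by ring.
    replace (1 + 1 * (M - 1)) with M by ring. ring. }
  destruct (Rle_or_lt (g l) 0) as [hg|hg]; [unfold g in hg; lra|exfalso].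
  assert (l0 : 0 < l).
  { destruct (Req_dec l 0) as [e|]; [rewrite e in hg|]; lra. }
  assert (l1 : l < 1).
  { destruct (Req_dec l 1) as [e|]; [rewrite e in hg|]; lra. }
  destruct (MVT_cor2 g _ 0 l l0 (fun c h => dg c ltac:(lra))) as [c1 [e1 h1]].
  destruct (MVT_cor2 g _ l 1 l1 (fun c h => dg c ltac:(lra))) as [c2 [e2 h2]].
  assert (q1 := Qpos c1 ltac:(lra)). assert (q2 := Qpos c2 ltac:(lra)).
  assert (s1 : D < (P - M) / Q c1) by nra.
  assert (s2 : (P - M) / Q c2 < D) by nra.
  apply Rlt_div_r in s1; [|lra]. apply Rlt_div_l in s2; [|lra].
  assert (hD : 0 < D) by lra.
  assert (s12 : Q c1 < Q c2) by nra.
  destruct (Rle_or_lt P 1) as [hP|hP].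
  - assert (Q c2 <= Q c1); [|lra].
    unfold Q. apply Rmult_le_compat; try nra; apply Rlt_le, segment_from_1_pos; lra.
  - assert (hM1 : M < 1) by nra.
    (* Concavity: [Q c1] is at least the interpolation of [Q 0 = 1] and [Q c2]. *)
    assert (conc : (c2 - c1) * 1 + c1 * Q c2 <= c2 * Q c1).
    { assert (0 <= (P - 1) * (1 - M) * (c1 * c2 * (c2 - c1))).
      { repeat apply Rmult_le_pos; lra. }
      unfold Q. nra. }
    assert (0 < (c2 - c1) * (1 - Q c1) + c1 * (Q c2 - Q c1)); [|lra].
    assert (Q c1 < 1) by nra.
    apply Rplus_lt_0_compat; apply Rmult_lt_0_compat; lra.
Qed.

(** * The slope at the origin *)

(** The derivative of the difference in [t] is
    [6/(1-t²) - 6 - 6t² = 6t⁴/(1-t²)]. *)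
Lemma cubic_le_log (t : R) : 0 <= t < 1 ->
  2 * (3 * t + t ^ 3) <= 3 * (ln (1 + t) - ln (1 - t)).
Proof.
  intros ht.
  set (g := fun x => 3 * (ln (1 + x) - ln (1 - x)) - 2 * (3 * x + x ^ 3)).
  assert (g0 : g 0 = 0).
  { unfold g. rewrite Rplus_0_r, Rminus_0_r. ring. }
  destruct (Req_dec t 0) as [->|nz]; [unfold g in g0; lra|].
  destruct (MVT_cor2 g (fun x => 6 * x ^ 4 / (1 - x ^ 2)) 0 t ltac:(lra))
    as [c [e hc]].
  { intros x hx. apply is_derive_Reals. unfold g.
    auto_derive; [repeat split; lra|]. field. split; [nra|lra]. }
  assert (0 <= 6 * c ^ 4 / (1 - c ^ 2)).
  { apply Rdiv_le_0_compat; [|nra].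
    apply Rmult_le_pos; [lra|apply pow_le; lra]. }
  assert (0 <= g t) by nra.
  unfold g in *. lra.
Qed.

(** This is the monotonicity of [arctanh (s/A) - s], whose derivative
    [A/(A² - s²) - 1] is nonnegative as soon as [A² - s² <= A]. *)
Lemma log_ratio_minus_increasing (A s0 s : R) :
  0 <= s0 <= s -> s < A -> A ^ 2 - s0 ^ 2 <= A ->
  ln (A + s0) - ln (A - s0) - 2 * s0 <= ln (A + s) - ln (A - s) - 2 * s.
Proof.
  intros hs hA hs0.
  set (g := fun x => ln (A + x) - ln (A - x) - 2 * x).
  change (g s0 <= g s).
  destruct (Req_dec s0 s) as [->|ne]; [lra|].
  destruct (MVT_cor2 g (fun x => 2 * (A - (A ^ 2 - x ^ 2)) / (A ^ 2 - x ^ 2))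
              s0 s ltac:(lra)) as [c [e hc]].
  { intros x hx. apply is_derive_Reals. unfold g.
    auto_derive; [repeat split; lra|]. field. split; [nra|lra]. }
  assert (0 <= 2 * (A - (A ^ 2 - c ^ 2)) / (A ^ 2 - c ^ 2)).
  { apply Rdiv_le_0_compat; nra. }
  nra.
Qed.

Lemma amgm3 (x y z : R) : 0 <= x -> 0 <= y -> 0 <= z ->
  x * y * z <= ((x + y + z) / 3) ^ 3.
Proof.
  intros hx hy hz.
  (* The difference of the two sides is a combination of these weighted
     squares. *)
  assert (0 <= (x + y + z) * ((x - y) ^ 2 + (y - z) ^ 2 + (z - x) ^ 2)) by
    (apply Rmult_le_pos; [lra|repeat apply Rplus_le_le_0_compat; apply pow2_ge_0]).
  assert (0 <= x * (y - z) ^ 2 + y * (z - x) ^ 2 + z * (x - y) ^ 2).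
  { repeat apply Rplus_le_le_0_compat; apply Rmult_le_pos;
      first [assumption | apply pow2_ge_0]. }
  nra.
Qed.

(** The logarithms on the right are those of the products of the [1 + ti] and
    of the [1 - ti], so their difference is twice the sum of the [arctanh ti].
    Keeping [A] and [S] as the variables lets [S] move while [A] stays fixed:
    it is lowered to 0 if [A <= 1], and otherwise to [3 t + t³], the value it
    takes when all the [ti] equal the [t] that gives the same [A]. *)
Lemma sum_le_sum_arctanh (t1 t2 t3 : R) :
  -1 < t1 < 1 -> -1 < t2 < 1 -> -1 < t3 < 1 ->
  let S := t1 + t2 + t3 + t1 * t2 * t3 in
  let A := 1 + (t1 * t2 + t2 * t3 + t3 * t1) in
  0 < S -> 2 * S <= ln (A + S) - ln (A - S).
Proof.
  intros h1 h2 h3 S A hS.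
  assert (hM : 0 < A - S).
  { replace (A - S) with ((1 - t1) * (1 - t2) * (1 - t3)) by (unfold A, S; ring).
    repeat apply Rmult_lt_0_compat; lra. }
  destruct (Rle_or_lt A 1) as [hA|hA].
  - assert (hc : A ^ 2 - 0 ^ 2 <= A) by (clearbody A S; nra).
    assert (H := log_ratio_minus_increasing A 0 S
                   ltac:(lra) ltac:(lra) hc).
    rewrite Rplus_0_r, Rminus_0_r in H. lra.
  - set (t := sqrt ((A - 1) / 3)).
    assert (ht0 : 0 <= t) by apply sqrt_pos.
    assert (htA : A = 1 + 3 * t ^ 2).
    { unfold t. rewrite pow2_sqrt; lra. }
    assert (hsq : t ^ 2 <= (t1 ^ 2 + t2 ^ 2 + t3 ^ 2) / 3).
    { assert (0 <= (t1 - t2) ^ 2 + (t2 - t3) ^ 2 + (t3 - t1) ^ 2)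
        by (repeat apply Rplus_le_le_0_compat; apply pow2_ge_0).
      unfold A in htA. lra. }
    assert (ht1 : t < 1) by nra.
    assert (hG : A ^ 2 - S ^ 2 <= (1 - t ^ 2) ^ 3).
    { replace (A ^ 2 - S ^ 2) with ((1 - t1 ^ 2) * (1 - t2 ^ 2) * (1 - t3 ^ 2))
        by (unfold A, S; ring).
      eapply Rle_trans; [apply amgm3; nra|]. apply pow_incr. nra. }
    assert (hs0 : 3 * t + t ^ 3 <= S).
    { assert (0 <= t ^ 3) by (apply pow_le; lra).
      apply Rsqr_incr_0; [|lra|lra]. unfold Rsqr.
      rewrite htA in hG. lra. }
    assert (hc : A ^ 2 - (3 * t + t ^ 3) ^ 2 <= A).
    { replace (A ^ 2 - (3 * t + t ^ 3) ^ 2) with ((1 - t ^ 2) ^ 3)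
        by (rewrite htA; ring).
      assert ((1 - t ^ 2) ^ 3 <= 1 ^ 3) by (apply pow_incr; nra). lra. }
    assert (0 <= t ^ 3) by (apply pow_le; lra).
    assert (H' := log_ratio_minus_increasing A (3 * t + t ^ 3) S
                   ltac:(lra) ltac:(lra) hc).
    replace (A + (3 * t + t ^ 3)) with ((1 + t) ^ 3) in H' by (rewrite htA; ring).
    replace (A - (3 * t + t ^ 3)) with ((1 - t) ^ 3) in H' by (rewrite htA; ring).
    rewrite !ln_pow in H' by lra. simpl INR in H'.
    assert (H2 := cubic_le_log t ltac:(lra)). lra.
Qed.

(** * From logarithms to arctanh *)

Lemma arctanh_div (x y : R) : 0 < y -> 0 < y + x -> 0 < y - x ->
  arctanh (x / y) = (ln (y + x) - ln (y - x)) / 2.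
Proof.
  intros hy hp hm. unfold arctanh.
  replace ((1 + x / y) / (1 - x / y)) with ((y + x) / (y - x)) by (field; lra).
  rewrite ln_div by lra. field.
Qed.

Lemma arctanh_ln (t : R) : -1 < t < 1 ->
  arctanh t = (ln (1 + t) - ln (1 - t)) / 2.
Proof. intros h. unfold arctanh. rewrite ln_div by lra. field. Qed.

Lemma arctanh_opp (t : R) : -1 < t < 1 -> arctanh (- t) = - arctanh t.
Proof.
  intros h. rewrite !arctanh_ln by lra.
  replace (1 + - t) with (1 - t) by ring.
  replace (1 - - t) with (1 + t) by ring. field.
Qed.

(** Adding [l * S] to [y], or subtracting it, gives a convex combination of 1
    and the product of the [1 + ti], or of the [1 - ti]; and [y] is the mean
    of the two. *)
Lemma dilation_pos (t1 t2 t3 l : R) :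
  -1 < t1 < 1 -> -1 < t2 < 1 -> -1 < t3 < 1 -> 0 <= l <= 1 ->
  let S := t1 + t2 + t3 + t1 * t2 * t3 in
  let y := 1 + l * (t1 * t2 + t2 * t3 + t3 * t1) in
  0 < y /\ 0 < y + l * S /\ 0 < y - l * S.
Proof.
  intros h1 h2 h3 hl S y.
  assert (hP : 0 < (1 + t1) * (1 + t2) * (1 + t3))
    by (repeat apply Rmult_lt_0_compat; lra).
  assert (hM : 0 < (1 - t1) * (1 - t2) * (1 - t3))
    by (repeat apply Rmult_lt_0_compat; lra).
  assert (eP : y + l * S = 1 + l * ((1 + t1) * (1 + t2) * (1 + t3) - 1))
    by (unfold y, S; ring).
  assert (eM : y - l * S = 1 + l * ((1 - t1) * (1 - t2) * (1 - t3) - 1))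
    by (unfold y, S; ring).
  assert (hp := segment_from_1_pos _ l hP hl).
  assert (hm := segment_from_1_pos _ l hM hl).
  lra.
Qed.

Lemma arctanh_dilation_le (t1 t2 t3 l : R) :
  -1 < t1 < 1 -> -1 < t2 < 1 -> -1 < t3 < 1 -> 0 <= l <= 1 ->
  0 < t1 + t2 + t3 + t1 * t2 * t3 ->
  arctanh (l * (t1 + t2 + t3 + t1 * t2 * t3) /
           (1 + l * (t1 * t2 + t2 * t3 + t3 * t1)))
  <= l * (arctanh t1 + arctanh t2 + arctanh t3).
Proof.
  intros h1 h2 h3 hl hS.
  destruct (dilation_pos t1 t2 t3 l h1 h2 h3 hl) as [hy [hp hm]].
  assert (hslope := sum_le_sum_arctanh t1 t2 t3 h1 h2 h3 hS).
  rewrite arctanh_div, !arctanh_ln by assumption.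
  cbv zeta in hslope.
  set (S := t1 + t2 + t3 + t1 * t2 * t3) in *.
  set (e := t1 * t2 + t2 * t3 + t3 * t1) in *.
  assert (eP : 1 + e + S = (1 + t1) * (1 + t2) * (1 + t3))
    by (unfold S, e; ring).
  assert (eM : 1 + e - S = (1 - t1) * (1 - t2) * (1 - t3))
    by (unfold S, e; ring).
  assert (hM : 0 < 1 + e - S).
  { rewrite eM. repeat apply Rmult_lt_0_compat; lra. }
  assert (hPM : (1 + e + S) * (1 + e - S) <= 1).
  { rewrite eP, eM.
    replace ((1 + t1) * (1 + t2) * (1 + t3) * ((1 - t1) * (1 - t2) * (1 - t3)))
      with ((1 - t1 ^ 2) * (1 - t2 ^ 2) * (1 - t3 ^ 2)) by ring.
    apply Rle_trans with (1 * 1 * 1); [|lra].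
    assert (forall t, -1 < t < 1 -> 0 <= 1 - t ^ 2 <= 1) as b by (intros; nra).
    destruct (b t1 h1), (b t2 h2), (b t3 h3).
    repeat apply Rmult_le_compat; try lra. apply Rmult_le_pos; lra. }
  assert (H := log_diff_below_chord (1 + e + S) (1 + e - S) l
                 ltac:(lra) hPM ltac:(lra) hl).
  replace (1 + l * (1 + e + S - 1)) with (1 + l * e + l * S) in H by ring.
  replace (1 + l * (1 + e - S - 1)) with (1 + l * e - l * S) in H by ring.
  rewrite eP, eM in H.
  rewrite !ln_mult in H by (try apply Rmult_lt_0_compat; lra).
  lra.
Qed.

Theorem theorem1 (t1 t2 t3 lambda : R)
  (ht1 : -1 < t1 < 1) (ht2 : -1 < t2 < 1) (ht3 : -1 < t3 < 1)
  (hlambda : 0 <= lambda <= 1) :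
  (t1 + t2 + t3 + t1 * t2 * t3) *
    arctanh (lambda * (t1 + t2 + t3 + t1 * t2 * t3) /
             (1 + lambda * (t1 * t2 + t2 * t3 + t3 * t1)))
  <= lambda * (t1 + t2 + t3 + t1 * t2 * t3) *
       (arctanh t1 + arctanh t2 + arctanh t3).
Proof.
  destruct (Rtotal_order (t1 + t2 + t3 + t1 * t2 * t3) 0) as [hS|[hS|hS]].
  - destruct (dilation_pos t1 t2 t3 lambda ht1 ht2 ht3 hlambda) as [hy [hp hm]].
    assert (H := arctanh_dilation_le (- t1) (- t2) (- t3) lambda
      ltac:(lra) ltac:(lra) ltac:(lra) hlambda ltac:(lra)).
    rewrite !(arctanh_opp t1), !(arctanh_opp t2), !(arctanh_opp t3) in H
      by assumption.
    set (S := t1 + t2 + t3 + t1 * t2 * t3) in *.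
    set (y := 1 + lambda * (t1 * t2 + t2 * t3 + t3 * t1)) in *.
    replace (1 + lambda * (- t1 * - t2 + - t2 * - t3 + - t3 * - t1))
      with y in H by (unfold y; ring).
    replace (lambda * (- t1 + - t2 + - t3 + - t1 * - t2 * - t3) / y)
      with (- (lambda * S / y)) in H by (unfold S; field; lra).
    rewrite arctanh_opp in H.
    + nra.
    + split; [apply Rlt_div_r|apply Rlt_div_l]; lra.
  - rewrite hS. lra.
  - assert (H := arctanh_dilation_le t1 t2 t3 lambda ht1 ht2 ht3 hlambda hS).
    nra.
Qed.
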